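(* Let $G$ be a group whose cardinality $\kappa=|G|$ is a singular cardinal, and suppose that $G$ is $\kappa$-normal. Then $G$ admits a maximal left invariant $\kappa$-bounded topology.
   Context: An infinite cardinal is singular if it is not equal to its cofinality. For an infinite group $G$ and an infinite cardinal $\kappa\le|G|$, $G$ is called $\kappa$-normal if every subset $F\subseteq G$ with $|F|<\kappa$ is contained in some normal subgroup $H$ of $G$ with $|H|<\kappa$. A topological space $X$ with no isolated points is called maximal if $X$ has an isolated point in any (strictly) stronger topology. A topology $\tau$ on a group $G$ is called left invariant if, for every $g\in G$, the left shift $x\mapsto gx$, $G\to G$, is continuous in $\tau$; a group endowed with a left invariant topology is called a left topological group. A left invariant topology on $G$ is called maximal if $G$ with this topology is maximal as a topological space (in particular, it has no isolated points). For a group $G$ of cardinality $\kappa$, a subset $A\subseteq G$ is left $\kappa$-large if there exists $F\subseteq G$ with $|F|<\kappa$ such that $G=FA$. A left topological group $G$ of cardinality $\kappa$ (or its topology) is called $\kappa$-bounded if each neighborhood $U$ of the identity $e$ (equivalently, each non-empty open subset of $G$) is left $\kappa$-large. *)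

(* Defs.v *)
From HB Require Import structures.
From mathcomp Require Import all_boot.
From mathcomp Require Import all_classical.
From mathcomp Require Import wochoice topology_structure.

Set Implicit Arguments.
Unset Strict Implicit.
Unset Printing Implicit Defensive.

Local Open Scope classical_set_scope.
Local Open Scope card_scope.
Local Open Scope group_scope.

(* Cardinals are represented by sets, up to [#=]; the cardinality of a type [T]
   is represented by [[set: T]]. *)

Definition card_lt T U (A : set T) (B : set U) : Prop :=
  A #<= B /\ A #!= B.

(* [R] orders [T] in the order type of the initial ordinal of [|T|]: each proper
   initial segment [{y | y < x}] has cardinality less than [|T|].  Such an [R]
   exists on every [T] and is unique up to isomorphism. *)
Definition initial_well_order T (R : rel T) : Prop :=
  well_order R /\ forall x, card_lt [set y | ~~ R x y] [set: T].

Definition cofinal T (R : rel T) (C : set T) : Prop :=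
  forall x, exists2 y, C y & R x y.

(* [|C|] is the cofinality of the cardinal [|T|]. *)
Definition is_cofinality T (C : set T) : Prop :=
  exists R : rel T, [/\ initial_well_order R, cofinal R C &
    forall D : set T, cofinal R D -> C #<= D].

Definition singular T : Prop :=
  infinite_set [set: T] /\
  exists C : set T, is_cofinality C /\ C #!= [set: T].

Definition normal_subgroup (G : groupType) (H : set G) : Prop :=
  group_closed (mem H) /\ forall x g : G, H x -> H (x ^ g).

(* [G] is kappa-normal for kappa = |K|. *)
Definition card_normal (G : groupType) T (K : set T) : Prop :=
  forall F : set G, card_lt F K ->
    exists H : set G, [/\ normal_subgroup H, F `<=` H & card_lt H K].

(* A topology on the carrier [X] is an element of the class [Topological X]. *)
Definition space X (t : Topological X) : topologicalType := Topological.Pack t.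

Definition strictly_stronger X (t' t : Topological X) : Prop :=
  @open (space t) `<=` @open (space t') /\
  @open (space t) <> @open (space t').

Definition has_isolated_point X (t : Topological X) : Prop :=
  isolated [set: space t] !=set0.

Definition maximal_topology X (t : Topological X) : Prop :=
  ~ has_isolated_point t /\
  forall t' : Topological X, strictly_stronger t' t -> has_isolated_point t'.

Definition left_invariant (G : groupType) (t : Topological G) : Prop :=
  forall g : G, continuous ((fun x : G => g * x) : space t -> space t).

(* Left kappa-large and, below, kappa-bounded, for kappa = |G|. *)
Definition left_large (G : groupType) (A : set G) : Prop :=
  exists2 F : set G, card_lt F [set: G] &
    [set: G] = [set f * a | f in F & a in A].

Definition card_bounded (G : groupType) (t : Topological G) : Prop :=
  forall U : set G, nbhs ((1 : G) : space t) U -> left_large U.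

(* Main.v *)
Require Import Defs.
From HB Require Import structures.
From mathcomp Require Import all_boot.
From mathcomp Require Import all_classical.
From mathcomp Require Import wochoice topology_structure.

(** Write k for the cardinal of [G] and call a set small if its cardinal is less
than k.  Call [B] thick if it contains a right translate [F * g] of every small
set [F].  A set that is not left k-large has a thick complement ([thick_setC]),
so an ultrafilter to which every thick set belongs consists of left k-large
sets.

Such an ultrafilter exists because thick sets are closed under intersection,
which is where both hypotheses enter ([thickI]).  Singularity covers [G] by small
sets [X y], with [y] in a small index set [C].  Given thick [B] and [B'] and a
small [F], choose for each [y] a small normal subgroup [H y] containing [F] and
[X y], and a translate [H y * b y] inside [B].  The set of all [b y] is small
too, so a small subgroup [K] contains it together with [F], and [K * c] lies in
[B'] for some [c].  Now [c] belongs to some [X y], and [F * (b y * c)] lies both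
in [K * c] and, as [H y] is normal, in [H y * b y].

Since left translates of thick sets are thick, the ultrafilters containing all
thick sets form a closed subsemigroup of the Stone-Cech compactification of [G].
The Ellis-Numakura theorem gives an idempotent [q] in it
([exists_idempotent_ultrafilter]).  Declare [U] open when [x^-1 * U] belongs to
[q] for all [x] in [U].  This topology is left invariant, and idempotency of [q]
makes the punctured neighborhoods of [x] exactly the members of the translated
ultrafilter [x * q] ([left_open_star]).  No isolated point means that the
singleton of [1] is not in [q], which holds as it is not left k-large; and since
punctured neighborhoods are ultrafilters, adding one more open set isolates a
point ([left_open_maximal]). *)

Set Implicit Arguments.
Unset Strict Implicit.
Unset Printing Implicit Defensive.

Local Open Scope classical_set_scope.
Local Open Scope card_scope.
Local Open Scope group_scope.

(** * Unions of sets of small cardinality *)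

Lemma rel_card_le T U (A : set T) (B : set U) (R : T -> U -> Prop) :
  (forall x, A x -> exists2 y, B y & R x y) ->
  (forall x x' y, R x y -> R x' y -> x = x') -> A #<= B.
Proof.
move=> RAB Rinj; have [[x0 Ax0]|A0] := pselect (A !=set0); last first.
  suff -> : A = set0 by exact: card_ge0.
  by apply/seteqP; split=> // x Ax; apply: A0; exists x.
have [y0 _ _] := RAB _ Ax0.
have /choice[f fP] x : exists y, A x -> B y /\ R x y.
  have [/RAB[y By Rxy]|nAx] := pselect (A x); first by exists y.
  by exists y0.
have finj : {in A &, injective f}.
  move=> x x' /set_mem Ax /set_mem Ax' ff.
  apply: (Rinj _ _ (f x)); first by case: (fP _ Ax).
  by rewrite ff; case: (fP _ Ax').
have /card_eqPle[_ /card_le_trans] := inj_card_eq finj; apply.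
by apply: subset_card_le => _ [x /fP[? _] <-].
Qed.

Definition one_to_one T U (R : set (T * U)) : Prop :=
  forall x y x' y', R (x, y) -> R (x', y') -> x = x' <-> y = y'.

Lemma one_to_one_bigcup T U (C : set (set (T * U))) :
  (forall R, C R -> one_to_one R) -> total_on C subset ->
  one_to_one (\bigcup_(R in C) R).
Proof.
move=> C11 Ctot x y x' y' [R CR Rxy] [S CS Sxy].
have [/(_ _ Rxy)|/(_ _ Sxy)] := Ctot _ _ CR CS; last exact: C11.
by move=> /(C11 _ CS); apply.
Qed.

(** A one-to-one relation between [A] and [B] that is maximal for inclusion must
exhaust [A] or exhaust [B], as it could otherwise be extended by a pair. *)
Lemma card_le_total T U (A : set T) (B : set U) : A #<= B \/ B #<= A.
Proof.
pose P (R : set (T * U)) := R `<=` A `*` B /\ one_to_one R.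
have [|R [[RAB R11] Rmax]] := @Zorn_bigcup _ P.
  move=> C CP Ctot; split; first by move=> x [R /CP[RAB _] /RAB].
  by apply: one_to_one_bigcup => // R /CP[].
have [Atot|/existsNP[a /not_implyP[Aa nRa]]] :=
    pselect (forall x, A x -> exists y, R (x, y)).
  left; apply: (@rel_card_le _ _ _ _ (fun x y => R (x, y))) =>
    [x Ax|x x' y Rx Rx'].
    by have [y Rxy] := Atot _ Ax; exists y => //; case: (RAB _ Rxy).
  exact/(R11 _ _ _ _ Rx Rx').
have [Btot|/existsNP[b /not_implyP[Bb nRb]]] :=
    pselect (forall y, B y -> exists x, R (x, y)).
  right; apply: (@rel_card_le _ _ _ _ (fun y x => R (x, y))) =>
    [y By|y y' x Rx Rx'].
    by have [x Rxy] := Btot _ By; exists x => //; case: (RAB _ Rxy).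
  exact/(R11 _ _ _ _ Rx Rx').
case: (Rmax (R `|` [set (a, b)])).
  split=> [x|RR]; first by left.
  by apply: nRa; exists b; apply: RR; right.
split=> [_ [/RAB//|->//]|x y x' y'].
move=> [Rxy|[-> ->]] [Rxy'|[-> ->]] //; first exact: R11.
- by split=> ?; subst; [case: nRa; exists y|case: nRb; exists x].
- by split=> ?; subst; [case: nRa; exists y'|case: nRb; exists x'].
Qed.

Lemma card_le_fun T U (A : set T) (B : set U) : A #<= B -> A !=set0 ->
  exists2 f : T -> U, (forall x, A x -> B (f x)) & {in A &, injective f}.
Proof.
elim/Ppointed: U => U in B *.
  by rewrite empty_eq0 => /card_le0P -> [].
move=> /pcard_leP[f] _; exists f; last exact: inj.
by move=> x Ax; exact: funS.
Qed.

Lemma card_le_setU T U (A B : set T) (D : set U) :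
  D `*` [set: bool] #<= D -> A #<= D -> B #<= D -> A `|` B #<= D.
Proof.
move=> DD AD BD; apply: card_le_trans DD.
have [[a Aa]|/nonemptyPn->] := pselect (A !=set0); last first.
  rewrite set0U; apply: card_le_trans BD _.
  apply: (@rel_card_le _ _ _ _ (fun x y => y = (x, true))) =>
    [x Dx|x x' _ -> [//]].
  by exists (x, true).
have [[b Bb]|/nonemptyPn->] := pselect (B !=set0); last first.
  rewrite setU0; apply: card_le_trans AD _.
  apply: (@rel_card_le _ _ _ _ (fun x y => y = (x, true))) =>
    [x Dx|x x' _ -> [//]].
  by exists (x, true).
have [|f fD finj] := card_le_fun AD; first by exists a.
have [|g gD ginj] := card_le_fun BD; first by exists b.
apply: (@rel_card_le _ _ _ _ (fun x y =>
  (A x /\ y = (f x, true)) \/ (B x /\ y = (g x, false)))).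
  move=> x [Ax|Bx]; first by exists (f x, true); [split=> //; exact: fD|left].
  by exists (g x, false); [split=> //; exact: gD|right].
move=> x x' y [[Ax ->]|[Bx ->]] [[Ax' []]|[Bx' []]] //.
  by move/finj; apply; exact: mem_set.
by move/ginj; apply; exact: mem_set.
Qed.

(** Take, by Zorn's lemma, a maximal injection [R] of [D * bool] into [D] with [D] a
subset of [A].  If [A \ D] contained a sequence, [R] could be extended by an
injection of two copies of the natural numbers into one; hence [A \ D] is finite
and [A] embeds into [D]. *)
Lemma card_le_double T (A : set T) : infinite_set A -> A `*` [set: bool] #<= A.
Proof.
move=> Ainf.
pose dom (R : set (T * bool * T)) := [set x | exists y, R (x, true, y)].
(* That [R] is total on [D * bool], with values in [D], is expressed by asking each
   pair of [R] for further pairs of [R]: in this form it survives unions of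
   chains. *)
pose P (R : set (T * bool * T)) := [/\ one_to_one R, dom R `<=` A &
  forall x b y, R (x, b, y) ->
    [/\ dom R x, dom R y & exists z, R (x, ~~ b, z)]].
have [|R [[R11 RA Rdom] Rmax]] := @Zorn_bigcup _ P.
  move=> C CP Ctot; split.
  - by apply: one_to_one_bigcup => // R /CP[].
  - by move=> x [y [R /CP[_ RA _] Rxy]]; apply: RA; exists y.
  - move=> x b y [R CR Rxy]; have [_ _ Rdom] := CP _ CR.
    have [[u Ru] [v Rv] [w Rw]] := Rdom _ _ _ Rxy.
    by split; [exists u|exists v|exists w]; exists R.
pose D := dom R.
have Rfun x b : D x -> exists2 y, D y & R (x, b, y).
  case=> y Rxy; have [_ Dy [z Rxz]] := Rdom _ _ _ Rxy.
  case: b; first by exists y.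
  by exists z => //; have [_ Dz _] := Rdom _ _ _ Rxz.
have fin : finite_set (A `\` D).
  apply: contrapT => /infiniteP Minf.
  have [g gAD g_inj] := card_le_fun Minf (ex_intro _ 0%N I).
  have ginj : injective g by move=> m n; apply: g_inj; rewrite inE.
  pose S : set (T * bool * T) :=
    [set p | exists n (b : bool), p = (g n, b, g (n.*2 + b)%N)].
  case: (Rmax (R `|` S)).
    split=> [x|RR]; first by left.
    have [_] := gAD 0%N I; apply; exists (g 1%N).
    by apply: RR; right; exists 0%N, true.
  have domRS x : dom (R `|` S) x <-> D x \/ exists n, x = g n.
    split=> [[y [Rxy|[n [b [-> _]]]]]|[[y Rxy]|[n ->]]].
    - by left; exists y.
    - by right; exists n.
    - by exists y; left.
    - by exists (g (n.*2 + true)%N); right; exists n, true.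
  split.
  - move=> [x b] y [x' b'] y'.
    move=> [Rxy|[n [c [-> -> ->]]]] [Rxy'|[n' [c' [-> -> ->]]]].
    + exact: R11.
    + have [Dx Dy _] := Rdom _ _ _ Rxy.
      by split=> [[xg _]|yg]; [have [_ []] := gAD n' I; rewrite -xg|
        have [_ []] := gAD (n'.*2 + c')%N I; rewrite -yg].
    + have [Dx Dy _] := Rdom _ _ _ Rxy'.
      by split=> [[xg _]|yg]; [have [_ []] := gAD n I; rewrite xg|
        have [_ []] := gAD (n.*2 + c)%N I; rewrite yg].
    + split=> [[/ginj -> ->]//|/ginj e].
      have := congr1 odd e; rewrite !oddD !odd_double !oddb /= => cc; subst c'.
      by move/addIn/double_inj: e => ->.
  - by move=> x /domRS[/RA//|[n ->]]; have [] := gAD n I.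
  - move=> x b y [Rxy|[n [c [-> -> ->]]]].
      have [Dx Dy [z Rz]] := Rdom _ _ _ Rxy.
      by split; [apply/domRS; left|apply/domRS; left|exists z; left].
    split; [apply/domRS; right; by exists n|apply/domRS; right; by eexists|].
    by exists (g (n.*2 + ~~ c)%N); right; exists n, (~~ c).
have DD : D `*` [set: bool] #<= D.
  apply: (@rel_card_le _ _ _ _ (fun x y => R (x, y))).
    by move=> [x b] [/= Dx _]; exact: Rfun.
  by move=> x x' y Rx Rx'; exact/(R11 _ _ _ _ Rx Rx').
have Dinf : infinite_set D.
  move=> Dfin; have ADfin : finite_set (A `\` D `|` D) by rewrite finite_setU.
  apply: Ainf; apply: (sub_finite_set _ ADfin) => x Ax.
  by have [?|?] := pselect (D x); [right|left].
have AD : A #<= D.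
  have ADD : A `\` D #<= D.
    by have [//|/card_le_finite/(_ fin)] := card_le_total (A `\` D) D.
  apply: card_le_trans (card_le_setU DD ADD (card_lexx D)).
  by apply: subset_card_le => x Ax; have [?|?] := pselect (D x); [right|left].
have slice (b : bool) : A `*` [set b] #<= D.
  apply: card_le_trans AD.
  apply: (@rel_card_le _ _ _ _ (fun x y => y = x.1 /\ x.2 = b)).
    by move=> [x c] [/= Ax ->]; exists x.
  by move=> [x c] [x' c'] y [-> /= ->] [-> /= ->].
apply: card_le_trans (card_le_trans (card_le_setU DD (slice true) (slice false))
  (subset_card_le RA)).
by apply: subset_card_le => -[x []] [/= Ax _]; [left|right].
Qed.

Lemma card_le_lt_trans T U V (A : set T) (B : set U) (K : set V) :
  A #<= B -> card_lt B K -> card_lt A K.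
Proof.
move=> AB [BK nBK]; split; first exact: card_le_trans BK.
apply: contra nBK => /card_eqPle[_ KA].
by apply/card_eqPle; split=> //; exact: card_le_trans AB.
Qed.

(** The larger of two infinite cardinals absorbs the smaller one.  This is what lets a
single small normal subgroup contain several small sets at once. *)
Lemma card_lt_setU T U (A B : set T) (K : set U) : infinite_set K ->
  card_lt A K -> card_lt B K -> card_lt (A `|` B) K.
Proof.
move=> Kinf; wlog AB : A B / A #<= B.
  move=> H AK BK; have [AB|BA] := card_le_total A B; first exact: H.
  by rewrite setUC; exact: H.
move=> AK BK; have [Bfin|Binf] := pselect (finite_set B).
  have ABfin : finite_set (A `|` B).
    by rewrite finite_setU; split=> //; exact: card_le_finite Bfin.
  split.
    by have [//|/card_le_finite/(_ ABfin)//] := card_le_total (A `|` B) K.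
  apply/negP => /card_eqPle[_ /card_le_finite/(_ ABfin)]; exact: Kinf.
apply: card_le_lt_trans BK.
exact: card_le_setU (card_le_double Binf) AB (card_lexx _).
Qed.

Lemma finite_card_lt T U (A : set T) (K : set U) :
  infinite_set K -> finite_set A -> card_lt A K.
Proof.
move=> Kinf Afin; split.
  by have [//|/card_le_finite/(_ Afin)] := card_le_total A K.
by apply/negP => /card_eqPle[_ /card_le_finite/(_ Afin)].
Qed.

(** * Idempotent ultrafilters *)

Lemma ultra_filterP T (F : set_system T) : ProperFilter F ->
  (forall A, F A \/ F (~` A)) -> UltraFilter F.
Proof.
move=> FF FC; split=> // H HF FH; apply/seteqP; split=> // A HA.
have [//|FnA] := FC A; have [] := @filter_not_empty _ H _.
by rewrite -(setICr A); apply: filterI => //; exact: FH.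
Qed.

Lemma filter_setCN T (F : set_system T) (A : set T) :
  ProperFilter F -> F A -> ~ F (~` A).
Proof.
move=> FF FA FnA; apply: (@filter_not_empty _ F _).
by rewrite -(setICr A); exact: filterI.
Qed.

(** The product of the Stone-Cech compactification of [S], for which right
multiplications are continuous.  With [H] an ultrafilter and [F] only a filter, it
describes the set of products [p * H], where [p] ranges over the closed set of
ultrafilters containing [F]. *)
Definition filter_mul (S : semigroupType) (F H : set_system S) : set_system S :=
  [set A | F [set x | H [set y | A (x * y)]]].

Lemma filter_mulA (S : semigroupType) (F H K : set_system S) :
  filter_mul (filter_mul F H) K = filter_mul F (filter_mul H K).
Proof.
apply/seteqP; split=> A; rewrite /filter_mul /=; congr F; apply/funext => x /=;
  congr H; apply/funext => y /=; congr K; apply/funext => z /=; by rewrite mulgA.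
Qed.

Lemma filter_mulSl (S : semigroupType) (F F' H : set_system S) :
  F `<=` F' -> filter_mul F H `<=` filter_mul F' H.
Proof. by move=> FF' A /FF'. Qed.

Lemma filter_mul_filter (S : semigroupType) (F H : set_system S) :
  Filter F -> Filter H -> Filter (filter_mul F H).
Proof.
move=> FF HF; split=> [|A B FA FB|A B AB].
- by apply: (filterS _ (filterT : F setT)) => x _; exact: filterT.
- by apply: filterS (@filterI _ F _ _ _ FA FB) => x [HA HB]; exact: filterI.
- by apply: (@filterS _ F _) => x; apply: filterS => y; exact: AB.
Qed.

Lemma filter_mul_proper (S : semigroupType) (F H : set_system S) :
  ProperFilter F -> ProperFilter H -> ProperFilter (filter_mul F H).
Proof.
move=> FF HF; apply: (Build_ProperFilter_ex _ (filter_mul_filter _ _)) => A FA.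
have [x /filter_ex[y Axy]] := @filter_ex _ F _ _ FA; by exists (x * y).
Qed.

Lemma filter_mul_ultra (S : semigroupType) (F H : set_system S) :
  UltraFilter F -> UltraFilter H -> UltraFilter (filter_mul F H).
Proof.
move=> FF HF; apply: (ultra_filterP (filter_mul_proper _ _)) => A.
have [FA|FA] := in_ultra_setVsetC [set x | H [set y | A (x * y)]] FF.
  by left.
right; apply: filterS FA => x /= nHA.
by have [//|] := in_ultra_setVsetC [set y | A (x * y)] HF.
Qed.

(** A filter stands for the closed set of ultrafilters containing it.  For
ultrafilters [q] and [r], that set consists here of the [s] containing [F] and
satisfying [s * q = r]. *)
Definition fiber (S : semigroupType) (F q r : set_system S) : set_system S :=
  filter_from [set P : set S * set S | F P.1 /\ r P.2]
    (fun P => P.1 `&` [set x | q [set y | P.2 (x * y)]]).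

Lemma fiber_proper (S : semigroupType) (F q r : set_system S) :
  ProperFilter F -> UltraFilter q -> ProperFilter r -> filter_mul F q `<=` r ->
  ProperFilter (fiber F q r).
Proof.
move=> FF qU rF Fqr; apply: filter_from_proper.
  apply: filter_from_filter; first by exists (setT, setT); split; exact: filterT.
  move=> [D B] [D' B'] [/= FD rB] [/= FD' rB']; exists (D `&` D', B `&` B') => /=.
    by split; exact: filterI.
  move=> x [[Dx D'x] qBB']; split; split=> //; apply: filterS qBB' => y; by case.
move=> [D B] [/= FD rB]; apply/set0P/negP => /eqP DB0.
apply: (filter_setCN rF rB); apply: Fqr; apply: filterS FD => x Dx.
have [qB|//] := in_ultra_setVsetC [set y | B (x * y)] qU.
by have : set0 x by rewrite -DB0; split.
Qed.

Lemma sub_fiber (S : semigroupType) (F q r : set_system S) : Filter r ->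
  F `<=` fiber F q r.
Proof.
by move=> rF D FD; exists (D, setT) => /=; [split=> //; exact: filterT|move=> x []].
Qed.

Lemma sub_fiber_mul (S : semigroupType) (F q r : set_system S) : Filter F ->
  r `<=` filter_mul (fiber F q r) q.
Proof.
by move=> FF B rB; exists (setT, B) => /=; [split=> //; exact: filterT|move=> x []].
Qed.

(** Compactness: the image of a closed set of ultrafilters under [s |-> s * q] is
closed, hence equal to the set of all ultrafilters containing [filter_mul F q]. *)
Lemma filter_mul_factor (S : semigroupType) (F q r : set_system S) :
  ProperFilter F -> UltraFilter q -> UltraFilter r -> filter_mul F q `<=` r ->
  exists s, [/\ UltraFilter s, F `<=` s & filter_mul s q = r].
Proof.
move=> FF qU rU Fqr; have fF : ProperFilter (fiber F q r) by apply: fiber_proper.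
have [s [sU fs]] := ultraFilterLemma fF.
exists s; split=> //; first by apply: subset_trans fs; exact: sub_fiber.
apply: (@max_filter _ r _); first exact: filter_mul_proper.
by apply: subset_trans (filter_mulSl fs); exact: sub_fiber_mul.
Qed.

(** The ultrafilters containing [F] form a closed subsemigroup, stated without
products of two ultrafilters: each right translate of this closed set by one of its
members [q] stays within it. *)
Definition semigroup_filter (S : semigroupType) (F : set_system S) : Prop :=
  ProperFilter F /\ forall q, UltraFilter q -> F `<=` q -> F `<=` filter_mul F q.

(** For a subsemigroup [T] and [q] in [T], [(T * q) * (T * q)] lies in [T * q],
because [q * T] lies in [T]. *)
Lemma semigroup_filter_mul (S : semigroupType) (F q : set_system S) :
  semigroup_filter F -> UltraFilter q -> F `<=` q ->
  semigroup_filter (filter_mul F q).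
Proof.
move=> [FF FS] qU Fq; split=> [|r rU Fqr]; first exact: filter_mul_proper.
have [s [sU Fs <-]] := filter_mul_factor FF qU rU Fqr.
have Fqs : F `<=` filter_mul q s.
  by apply: subset_trans (FS _ sU Fs) _; exact: filter_mulSl.
rewrite -filter_mulA (filter_mulA F q); apply: filter_mulSl.
by apply: FS => //; exact: filter_mul_ultra.
Qed.

(** The stabilizer of [q] in a semigroup of ultrafilters: [s * q = q] and
[r * q = q] imply [s * r * q = q].  It is not empty as soon as [q] belongs to
[T * q], which the last hypothesis says. *)
Lemma semigroup_filter_fiber (S : semigroupType) (F q : set_system S) :
  semigroup_filter F -> UltraFilter q -> F `<=` q -> filter_mul F q `<=` q ->
  semigroup_filter (fiber F q q).
Proof.
move=> [FF FS] qU Fq Fqq.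
have fF : ProperFilter (fiber F q q) by apply: fiber_proper.
split=> // r rU fr; have qr : filter_mul r q = q.
  apply: (@max_filter _ q _); first exact: filter_mul_proper.
  by apply: subset_trans (filter_mulSl fr); exact: sub_fiber_mul.
have cF : Filter (filter_mul (fiber F q q) r) by exact: filter_mul_filter.
move=> A [[D B] [/= FD qB] DBA]; apply: filterS DBA _; apply: filterI.
  have Fr : F `<=` r by apply: subset_trans fr; exact: sub_fiber.
  have : filter_mul F r D by exact: FS FD.
  by apply: filter_mulSl; exact: sub_fiber.
suff : filter_mul (filter_mul (fiber F q q) r) q B by [].
by rewrite filter_mulA qr; exact: sub_fiber_mul.
Qed.

(** The existence of minimal closed subsemigroups, by Zorn's lemma: the union of a
chain of filters stands for the intersection of the closed sets. *)
Lemma maximal_semigroup_filter (S : semigroupType) (F : set_system S) :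
  semigroup_filter F -> exists2 M, F `<=` M &
    semigroup_filter M /\ forall H, semigroup_filter H -> M `<=` H -> H `<=` M.
Proof.
move=> FS.
(* The empty family is admitted only for the union of the empty chain. *)
pose P (M : set_system S) := M = set0 \/ F `<=` M /\ semigroup_filter M.
have [|M [PM Mmax]] := @Zorn_bigcup _ P.
  move=> C CP Ctot; have [[M [CM MN0]]|C0] := pselect (exists M, C M /\ M <> set0).
    right; have N0P N A : C N -> N A -> F `<=` N /\ semigroup_filter N.
      by move=> CN NA; have [N0|//] := CP _ CN; move: NA; rewrite N0.
    have [//|[FM MS]] := CP _ CM.
    split; first by move=> A FA; exists M => //; exact: FM.
    split=> [|q qU Cq A [N CN NA]].
      apply: Build_ProperFilter_ex.
        by move=> A [N CN NA]; have [_ [NF _]] := N0P _ _ CN NA; exact: filter_ex NA.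
      split.
      - by exists M => //; case: MS => MF _; exact: filterT.
      - move=> A B [N CN NA] [N' CN' NB].
        have [_ [NF _]] := N0P _ _ CN NA; have [_ [NF' _]] := N0P _ _ CN' NB.
        have [NN'|NN'] := Ctot _ _ CN CN'; [exists N'|exists N] => //.
          by apply: filterI => //; exact: NN'.
        by apply: filterI => //; exact: NN'.
      - move=> A B AB [N CN NA]; have [_ [NF _]] := N0P _ _ CN NA.
        by exists N => //; exact: filterS NA.
    have [_ [NF NS]] := N0P _ _ CN NA.
    exists N => //; apply: NS NA => //.
    by apply: subset_trans Cq => B NB; exists N.
  left; apply/seteqP; split=> // A [M CM MA].
  by case: C0; exists M; split=> // M0; move: MA; rewrite M0.
have [M0|[FM MS]] := PM.
  case: (Mmax F); last by right; split=> //; exact: subset_refl.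
  rewrite M0; split=> // /(_ setT); apply; case: FS => FF _; exact: filterT.
exists M => //; split=> // H HS MH; apply: contrapT => nHM.
by apply: (Mmax H) => //; right; split=> //; exact: subset_trans MH.
Qed.

(** Ellis-Numakura.  For [q] in a minimal closed subsemigroup [M], minimality gives
first [M * q = M], so that some [s] in [M] satisfies [s * q = q], and then that all
[s] in [M] do, among them [q] itself. *)
Lemma exists_idempotent_ultrafilter (S : semigroupType) (F : set_system S) :
  semigroup_filter F ->
  exists q, [/\ UltraFilter q, F `<=` q & q `<=` filter_mul q q].
Proof.
move=> /maximal_semigroup_filter[M FM [MS Mmax]]; have [MF MSq] := MS.
have [q [qU Mq]] := ultraFilterLemma MF.
have Mqq : filter_mul M q `<=` q.
  apply: (subset_trans _ Mq); apply: Mmax; first exact: semigroup_filter_mul.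
  exact: MSq.
exists q; split=> //; first exact: subset_trans Mq.
have fM : fiber M q q `<=` M.
  by apply: Mmax; [exact: semigroup_filter_fiber|exact: sub_fiber].
apply: subset_trans (filter_mulSl Mq); apply: subset_trans (filter_mulSl fM).
exact: sub_fiber_mul.
Qed.

(** * Thick sets *)

(** The initial segments up to the points of a cofinal set cover [T]. *)
Lemma singular_cover (T : eqType) : singular T ->
  exists (C : set T) (X : T -> set T), [/\ card_lt C [set: T],
    forall y, card_lt (X y) [set: T] & forall x, exists2 y, C y & X y x].
Proof.
move=> [Tinf [C [[R [[Rwo Rsmall] CR _]] nCT]]].
exists C, (fun y => [set z | R z y]); split=> // [|y].
  by split=> //; exact: card_leT.
apply: (@card_le_lt_trans _ _ _ _ ([set z | ~~ R y z] `|` [set y])); last first.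
  by apply: card_lt_setU => //; apply: finite_card_lt.
have Ranti : antisymmetric R.
  have : wo_chain R predT by move=> A _; exact: Rwo.
  by move/wo_chain_antisymmetric => Ra x x'; apply: Ra.
apply: subset_card_le => z /= Rzy; case: (boolP (R y z)) => Ryz; [right|by left].
by apply: Ranti; rewrite Rzy Ryz.
Qed.

Definition thick (G : groupType) (B : set G) : Prop :=
  forall F : set G, card_lt F [set: G] -> exists g, forall f, F f -> B (f * g).

(** [F * (b y * c)] lies in [K * c], and also in [F * c ^ (b y)^-1 * b y], which is
within [H y * b y] by normality; the point is that [K] is chosen after all the
[b y], and [y] only after [c]. *)
Lemma thickI (G : groupType) : singular G -> card_normal G [set: G] ->
  setI_closed (@thick G).
Proof.
move=> Gsing Gnormal B B' Bthick B'thick F Fsmall.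
have Ginf : infinite_set [set: G] by case: Gsing.
have [C [X [Csmall Xsmall Xcover]]] := singular_cover Gsing.
have /choice[H] y : exists H : set G, [/\ normal_subgroup H, F `|` X y `<=` H &
    exists b, forall h, H h -> B (h * b)].
  have [H [Hnormal FXH Hsmall]] := Gnormal _ (card_lt_setU Ginf Fsmall (Xsmall y)).
  by exists H; split=> //; exact: Bthick.
move=> HP; have /choice[b bP] y : exists b, forall h, H y h -> B (h * b).
  by have [] := HP y.
have bCsmall : card_lt (b @` C) [set: G].
  exact: card_le_lt_trans (card_image_le _ _) Csmall.
have [K [[Kgroup _] FbK Ksmall]] := Gnormal _ (card_lt_setU Ginf Fsmall bCsmall).
have [c Kc] := B'thick _ Ksmall; have [y Cy Xyc] := Xcover c.
have [[Hgroup HJ] FXH _] := HP y.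
exists (b y * c) => f Ff; split.
  have -> : f * (b y * c) = f * c ^ (b y)^-1 * b y.
    by rewrite /conjg invgK !mulgA mulgVK.
  apply: bP; apply: set_mem; apply: (group_closedM Hgroup); apply: mem_set.
    by apply: FXH; left.
  by apply: HJ; apply: FXH; right.
rewrite mulgA; apply: Kc; apply: set_mem; apply: (group_closedM Kgroup);
  apply: mem_set; apply: FbK; first by left.
by right; exists y.
Qed.

Lemma thick_filter (G : groupType) : singular G -> card_normal G [set: G] ->
  ProperFilter (@thick G).
Proof.
move=> Gsing Gnormal; have Ginf : infinite_set [set: G] by case: Gsing.
apply: Build_ProperFilter_ex.
  move=> B Bthick.
  have [|g /(_ 1 erefl) Bg] := Bthick [set 1]; first exact: finite_card_lt.
  by exists (1 * g).
split; first by move=> F _; exists 1.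
- exact: thickI.
- by move=> A B AB Athick F /Athick[g gP]; exists g => f /gP/AB.
Qed.

Lemma thick_translate (G : groupType) (B : set G) (x : G) :
  thick B -> thick [set y | B (x * y)].
Proof.
move=> Bthick F Fsmall.
have [|g gP] := Bthick [set x * f | f in F].
  exact: card_le_lt_trans (card_image_le _ _) Fsmall.
by exists g => f Ff /=; rewrite mulgA; apply: gP; exists f.
Qed.

Lemma thick_semigroup_filter (G : groupType) :
  singular G -> card_normal G [set: G] -> semigroup_filter (@thick G).
Proof.
move=> Gsing Gnormal; have tF := thick_filter Gsing Gnormal; split=> // q _ tq B tB.
apply: (filterS _ (filterT : thick [set: G])) => x _.
by apply: tq; exact: thick_translate.
Qed.

(** Inverting the small set turns a failure of [G = F^-1 * A] into a right translate
of [F] that avoids [A]. *)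
Lemma thick_setC (G : groupType) (A : set G) : ~ left_large A -> thick (~` A).
Proof.
move=> Anlarge F Fsmall; apply: contrapT => nthick; apply: Anlarge.
exists [set f^-1 | f in F]; first exact: card_le_lt_trans (card_image_le _ _) Fsmall.
apply/seteqP; split=> // g _; have /existsNP[f /not_implyP[Ff /contrapT Afg]] :
    ~ forall f, F f -> (~` A) (f * g) by move=> gP; apply: nthick; exists g.
by exists f^-1; [exists f|exists (f * g) => //; rewrite mulKg].
Qed.

Lemma left_large_set1 (G : groupType) (x : G) : ~ left_large [set x].
Proof.
move=> [F Fsmall GF]; have : card_lt [set: G] [set: G].
  apply: card_le_lt_trans Fsmall; rewrite GF.
  apply: card_le_trans (card_image_le (fun f => f * x) F).
  by apply: subset_card_le => _ [f Ff [_ -> <-]]; exists f.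
by case=> _; rewrite card_eqxx.
Qed.

(** * The topology of an idempotent ultrafilter *)

(** A copy of [X] that remembers the family of open sets, so that the structure of
topological space can be attached to it. *)
Definition open_sets_type (X : choiceType) (op : set_system X) (opT : op setT)
  (opI : setI_closed op) (opU : forall (I : Type) (f : I -> set X),
    (forall i, op (f i)) -> op (\bigcup_i f i)) : Type := X.

HB.instance Definition _ X op opT opI opU :=
  Choice.copy (@open_sets_type X op opT opI opU) X.

HB.instance Definition _ X op opT opI opU :=
  isOpenTopological.Build (@open_sets_type X op opT opI opU) opT opI opU.

Lemma topology_of_open X (op : set_system X) : op setT -> setI_closed op ->
  (forall (I : Type) (f : I -> set X), (forall i, op (f i)) ->
    op (\bigcup_i f i)) ->
  exists t : Topological X, @open (space t) = op.
Proof.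
elim/Pchoice: X => X in op *; move=> opT opI opU.
by exists (Topological.class (open_sets_type opT opI opU)).
Qed.

(** The finest left invariant topology in which [q] converges to the identity. *)
Definition left_open (G : groupType) (q : set_system G) : set_system G :=
  [set U | forall x, U x -> q [set y | U (x * y)]].

Lemma left_open_topology (G : groupType) (q : set_system G) : Filter q ->
  exists t : Topological G, @open (space t) = left_open q.
Proof.
move=> qF; apply: topology_of_open.
- by move=> x _; exact: filterT.
- by move=> U V qU qV x [Ux Vx]; apply: filterI; [exact: qU|exact: qV].
- move=> I f qf x [i _ fix_]; apply: filterS (qf i x fix_) => y fiy.
  by exists i.
Qed.

Lemma left_open_invariant (G : groupType) (q : set_system G) (t : Topological G) :
  Filter q -> @open (space t) = left_open q -> left_invariant t.
Proof.
move=> qF tq g; apply/continuousP => U; rewrite !tq => qU x /= Ugx.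
by apply: filterS (qU _ Ugx) => y /=; rewrite mulgA.
Qed.

(** Members of [q] yield neighborhoods: when [q] is idempotent, the points [y] of [A]
with [y^-1 * A] in [q] form a member of [q] with the same property relative to
itself, so that together with [1] they form an open set. *)
Lemma left_open_star (G : groupType) (q : set_system G) (A : set G) (x : G) :
  ProperFilter q -> q `<=` filter_mul q q -> q A ->
  exists U, [/\ left_open q U, U x & forall y, U (x * y) -> y = 1 \/ A y].
Proof.
move=> qF qq qA; pose star := [set y | A y /\ q [set z | A (y * z)]].
have qstar : q star by apply: filterI => //; exact: qq.
have star_open y : star y -> q [set z | star (y * z)].
  move=> [_ qAy]; apply: filterS (filterI qAy (qq _ qAy)) => z [/= Ayz].
  by move=> qAyz; split=> //; apply: filterS qAyz => w /=; rewrite mulgA.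
exists [set z | z = x \/ star (x^-1 * z)]; split=> [z||y /=].
- move=> [->|sz].
    by apply: filterS qstar => y sy; right; rewrite mulKg.
  by apply: filterS (star_open _ sz) => y sy; right; rewrite mulgA.
- by left.
- rewrite mulKg => -[xy|[Ay _]]; [left|by right].
  by apply: (@mulgI _ x); rewrite mulg1.
Qed.

(** A set [U] open in a strictly finer topology fails to be a neighborhood, in the
given one, of some [x] in [U]; by the ultrafilter property the complement of [U] is
then a punctured neighborhood of [x], so that [x] is isolated in the finer one. *)
Lemma left_open_maximal (G : groupType) (q : set_system G) (t : Topological G) :
  UltraFilter q -> q `<=` filter_mul q q -> ~ q [set 1] ->
  @open (space t) = left_open q -> maximal_topology t.
Proof.
move=> qU qq q1 tq; split.
  move=> [x [_ [V]]]; rewrite nbhsE setIT => -[W [Wopen Wx] WV] Vx.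
  apply: q1; move: Wopen; rewrite tq => /(_ _ Wx); apply: filterS => y /= Wxy.
  have : V (x * y) by exact: WV.
  by rewrite Vx => xy; apply: (@mulgI _ x); rewrite mulg1.
move=> t' [tt' ntt'].
have [U [U' nU]] : exists U, @open (space t') U /\ ~ left_open q U.
  apply: contrapT => nex; apply: ntt'; rewrite tq in tt' *.
  apply/seteqP; split=> // U U'; apply: contrapT => nU; apply: nex; by exists U.
have [x /not_implyP[Ux nqU]] : exists x, ~ (U x -> q [set y | U (x * y)]).
  exact/existsNP.
have [//|qUC] := in_ultra_setVsetC [set y | U (x * y)] qU.
have [W [Wopen Wx WA]] := left_open_star x (ultra_proper (F := q)) qq qUC.
exists x; split; first exact: mem_set.
exists (W `&` U).
  apply: open_nbhs_nbhs; split=> //; apply: openI => //.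
  by apply: tt'; rewrite tq.
rewrite setIT; apply/seteqP; split=> [y [Wy Uy]|_ ->//].
have [|xy1|] := WA (x^-1 * y); rewrite /= ?mulVKg //.
by rewrite -(mulVKg x y) xy1 mulg1.
Qed.

(** * Maximal bounded topologies *)

Theorem theorem5 (G : groupType) :
  singular G ->
  card_normal G [set: G] ->
  exists t : Topological G,
    [/\ maximal_topology t, left_invariant t & card_bounded t].
Proof.
move=> Gsing Gnormal.
have [q [qU tq qq]] :=
  exists_idempotent_ultrafilter (thick_semigroup_filter Gsing Gnormal).
have qlarge A : q A -> left_large A.
  move=> qA; apply: contrapT => /thick_setC/tq; exact: filter_setCN.
have [t tE] := left_open_topology (ultra_proper (F := q)).
exists t; split.
- by apply: (left_open_maximal qU qq) => // /qlarge; exact: left_large_set1.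
- exact: (left_open_invariant _ tE).
- move=> U; rewrite nbhsE => -[V [Vopen V1] VU]; apply: qlarge.
  move: Vopen; rewrite tE => /(_ _ V1); apply: filterS => y /=.
  by rewrite mul1g => /VU.
Qed.
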